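(* Let $\lambda>-1$, $t\in\mathbb{R}$, and let $\{S_n(x;t)\}_{n=0}^{\infty}$ be the monic orthogonal polynomials with respect to the generalized Freud weight $w(x;t)=|x|^{2\lambda+1}\exp(-x^4+tx^2)$ on $\mathbb{R}$, with recurrence coefficients $\beta_n=\beta_n(t;\lambda)$ in $$xS_n(x;t)=S_{n+1}(x;t)+\beta_nS_{n-1}(x;t),\qquad S_{-1}(x;t)=0,\ S_0(x;t)=1 .$$ Then $S_n(x;t)$ satisfies the differential equation $$x\frac{d^2S_n}{dx^2}(x;t)+R_n(x;t)\frac{dS_n}{dx}(x;t)+T_n(x;t)S_n(x;t)=0,$$ where $$R_n(x;t)=-4x^4+2tx^2+2\lambda+1-\frac{2x^2}{x^2-\tfrac12t+\beta_n+\beta_{n+1}},$$ $$\begin{aligned}T_n(x;t)={}&4nx^3+16x\beta_n\left(\beta_n+\beta_{n+1}-\tfrac12t\right)\left(\beta_n+\beta_{n-1}-\tfrac12t\right)+4x\left[1+(2\lambda+1)(-1)^n\right]\beta_n\\&-\frac{8\beta_nx^3+(2\lambda+1)[1-(-1)^n]x}{x^2-\tfrac12t+\beta_n+\beta_{n+1}}+(2\lambda+1)[1-(-1)^n]\,x\left(t-\frac{1}{2x^2}\right).\end{aligned}$$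
   Context: Orthogonality means $\int_{-\infty}^\infty S_n(x;t)S_m(x;t)w(x;t)\,dx=h_n\delta_{mn}$ with $h_n>0$. Convention: $\beta_0=0$; $n$ ranges over the positive integers. The equation is understood at those $x$ where the coefficients are defined, i.e. where the denominators ($x$ and $x^2-\tfrac12t+\beta_n+\beta_{n+1}$) do not vanish. *)

(* Defs.v *)
From HB Require Import structures.
From mathcomp Require Import all_boot all_order all_algebra.
From mathcomp Require Import all_classical all_reals all_analysis.

Set Implicit Arguments.
Unset Strict Implicit.
Unset Printing Implicit Defensive.

Import Order.TTheory GRing.Theory Num.Theory.
Import numFieldNormedType.Exports.

Local Open Scope classical_set_scope.
Local Open Scope ring_scope.

(* At x = 0 the library sets 0 `^ a = 0 for a != 0, also when a < 0; this is a
   null set, so the integrals below do not depend on the convention. *)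
Definition freud_weight (R : realType) (lambda t x : R) : R :=
  `|x| `^ (2 * lambda + 1) * expR (- x ^+ 4 + t * x ^+ 2).

(* The integral is extended-real valued, so equating it with a real number also
   says that it is finite. *)
Definition monic_orthogonal_polys (R : realType) (w : R -> R)
    (S : nat -> {poly R}) : Prop :=
  (forall n, S n \is monic /\ size (S n) = n.+1) /\
  exists2 h : nat -> R, (forall n, 0 < h n) &
    forall m n, (\int[@lebesgue_measure R]_(x in [set: R])
                   ((S n).[x] * (S m).[x] * w x)%:E)%E
                = (h n * (m == n)%:R)%:E.

(* S_(n-1), with S_(-1) = 0 *)
Definition prev_poly (R : realType) (S : nat -> {poly R}) (n : nat) : {poly R} :=
  if n is k.+1 then S k else 0.

(* beta_0 multiplies S_(-1) = 0, so the recurrence leaves it free; its value is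
   the convention beta_0 = 0. *)
Definition recurrence_coefs (R : realType) (S : nat -> {poly R})
    (beta : nat -> R) : Prop :=
  [/\ S 0%N = 1, beta 0%N = 0 &
      forall n, 'X * S n = S n.+1 + beta n *: prev_poly S n].

Section Coefficients.
Context (R : realType) (lambda t : R) (beta : nat -> R) (n : nat) (x : R).

Definition freud_den : R := x ^+ 2 - t / 2 + beta n + beta n.+1.

Definition freud_R : R :=
  - 4 * x ^+ 4 + 2 * t * x ^+ 2 + 2 * lambda + 1 - 2 * x ^+ 2 / freud_den.

(* beta n.-1 is beta_(n-1) only for n > 0. *)
Definition freud_T : R :=
  4 * n%:R * x ^+ 3
  + 16 * x * beta n * (beta n + beta n.+1 - t / 2)
      * (beta n + beta n.-1 - t / 2)
  + 4 * x * (1 + (2 * lambda + 1) * (-1) ^+ n) * beta n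
  - (8 * beta n * x ^+ 3 + (2 * lambda + 1) * (1 - (-1) ^+ n) * x) / freud_den
  + (2 * lambda + 1) * (1 - (-1) ^+ n) * x * (t - 1 / (2 * x ^+ 2)).

End Coefficients.

(* Main.v *)
Require Import Defs.
From HB Require Import structures.
From mathcomp Require Import all_boot all_order all_algebra.
From mathcomp Require Import all_classical all_reals all_analysis.
From mathcomp Require Import measurable_realfun ring lra.

Import Order.TTheory GRing.Theory Num.Theory.
Import numFieldNormedType.Exports.

Local Open Scope classical_set_scope.
Local Open Scope ring_scope.

(** The differential equation is the elimination of the previous polynomial
    from a pair of first order ladder relations, and those relations rest on a
    single analytic fact.

    Put al = 2 lambda + 1. Away from 0 the weight satisfies
    x w'(x) = (al + 2 t x^2 - 4 x^4) w(x), so for every polynomial p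
      (x p w)' = (p + x p' + (al + 2 t x^2 - 4 x^4) p) w.
    Since al + 1 > 0, x p(x) w(x) vanishes both at 0 and at infinity, and the
    integral of the right-hand side over the line is 0 [integral_pearson].
    The factor x is what makes this work for al < 0, where w is unbounded
    at 0.

    Taking p = S_n^2 and computing the moments of x^2 S_n^2 and x^4 S_n^2 with
    the recurrence gives F_n + F_(n+1) = 2 n + 1 + al, where
    F_n = 4 beta_n (beta_(n-1) + beta_n + beta_(n+1) - t/2). As F_0 = 0, this
    solves to the discrete Painleve equation
    F_n = n + al (1 - (-1)^n) / 2 [string_equation].

    From there everything is algebra. By induction on n, the recurrence and the
    string equation give the lowering relation
      x S_n' = 4 beta_n x (x^2 + beta_n + beta_(n+1) - t/2) S_(n-1)
               - (4 beta_n x^2 + al (1 - (-1)^n) / 2) S_n       [lowering].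
    The same relation at n - 1, in which the recurrence replaces
    beta_(n-1) S_(n-2) by x S_(n-1) - S_n, expresses x S_(n-1)' through S_(n-1)
    and S_n. Differentiating the relation at n and eliminating S_(n-1) and
    S_(n-1)' yields the equation [ladder_elimination, freud_ode]. *)

(** * Polynomials generated by a monic sequence *)

Lemma monic_seq_span (R : realType) (S : nat -> {poly R})
    (P : {poly R} -> Prop) (n : nat) :
    (forall k, S k \is monic /\ size (S k) = k.+1) ->
    P 0 -> (forall p q, P p -> P q -> P (p + q)) ->
    (forall (c : R) p, P p -> P (c *: p)) ->
    (forall k, (k < n)%N -> P (S k)) ->
  forall p : {poly R}, (size p <= n)%N -> P p.
Proof.
move=> hS P0 PD PZ; elim: n => [|n IHn] PS p.
  by rewrite leqn0 size_poly_eq0 => /eqP ->.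
move=> szp; rewrite -(subrK (p`_n *: S n) p).
apply: PD; last exact/PZ/PS.
apply: IHn => [k ltkn|]; first by apply: PS; exact: ltnW.
have [/monicP mS sS] := hS n.
apply/leq_sizeP => j; rewrite leq_eqVlt => /predU1P[<-|ltnj].
  rewrite coefB coefZ; move: mS; rewrite lead_coefE sS /= => ->.
  by rewrite mulr1 subrr.
rewrite coefB coefZ (nth_default _ (leq_trans szp ltnj)).
rewrite [X in _ * X]nth_default ?sS //.
by rewrite mulr0 subrr.
Qed.

(** * The string equation for the recurrence coefficients *)

(** The polynomial factor of w in the derivative of x p w. *)
Definition pearson_poly {R : realType} (al t : R) (p : {poly R}) : {poly R} :=
  p + 'X * p^`() + (al%:P + (2 * t) *: 'X^2 - 4 *: 'X^4) * p.

(** The left-hand side F_n of the discrete Painleve equation. At n = 0 the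
    index n.-1 is 0 and not -1; there beta 0 = 0 makes F_0 = 0 all the same. *)
Definition freud_string {R : realType} (t : R) (beta : nat -> R) (n : nat) : R :=
  4 * beta n * (beta n.-1 + beta n + beta n.+1 - t / 2).

Definition parity_part {R : realType} (al : R) (n : nat) : R :=
  al * (1 - (-1) ^+ n) / 2.

(** The argument only sees the weight through its moment functional L, for which
    the S n are orthogonal and the Pearson identity holds. *)
Section StringEquation.
Variables (R : realType) (al t : R) (S : nat -> {poly R}).
Variables (beta h : nat -> R).
Hypothesis S_monic : forall n, S n \is monic /\ size (S n) = n.+1.
Hypothesis beta0 : beta 0%N = 0.
Hypothesis recS : forall n, 'X * S n = S n.+1 + beta n *: prev_poly S n.

Variable L : {poly R} -> R.
Hypothesis LD : forall p q, L (p + q) = L p + L q.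
Hypothesis LZ : forall c p, L (c *: p) = c * L p.
Hypothesis h_gt0 : forall n, 0 < h n.
Hypothesis LSS : forall m n, L (S n * S m) = h n * (m == n)%:R.
Hypothesis pearson : forall p : {poly R}, L (pearson_poly al t p) = 0.

Let LSSn n : L (S n * S n) = h n.
Proof. by rewrite LSS eqxx mulr1. Qed.

Let LSSne m n : m != n -> L (S n * S m) = 0.
Proof. by move=> /negbTE mn; rewrite LSS mn mulr0. Qed.

Let LN p : L (- p) = - L p.
Proof. by rewrite -scaleN1r LZ mulN1r. Qed.

Let recSS n : 'X * S n.+1 = S n.+2 + beta n.+1 *: S n.
Proof. exact: recS. Qed.

Let recS0 : 'X * S 0%N = S 1%N.
Proof. by rewrite recS scaler0 addr0. Qed.

Lemma orthogonal_lower (n : nat) (q : {poly R}) :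
  (size q <= n)%N -> L (S n * q) = 0.
Proof.
apply: (@monic_seq_span R S (fun q => L (S n * q) = 0)) => //.
- by rewrite mulr0 -(scale0r 0) LZ mul0r.
- by move=> p r Lp Lr; rewrite mulrDr LD Lp Lr addr0.
- by move=> c p Lp; rewrite -scalerAr LZ Lp mulr0.
- by move=> k ltkn; rewrite LSSne // ltn_eqF.
Qed.

(** Both sides are L (x S_n S_(n+1)), with x absorbed into either factor. *)
Lemma norm_succ n : h n.+1 = beta n.+1 * h n.
Proof.
have E : L ('X * S n.+1 * S n) = beta n.+1 * h n.
  rewrite recSS mulrDl LD -scalerAl LZ LSSn LSSne ?add0r //.
  by rewrite neq_ltn !ltnS leqnSn.
rewrite -E -[_ * S n.+1]mulrC -mulrA recS mulrDr LD LSSn.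
rewrite -scalerAr LZ; case: n {E} => [|n] /=.
  by rewrite beta0 mul0r addr0.
by rewrite LSSne ?mulr0 ?addr0 // neq_ltn !ltnS leqnSn.
Qed.

Lemma second_moment n : L ('X^2 * (S n * S n)) = (beta n.+1 + beta n) * h n.
Proof.
rewrite (_ : _ * _ = ('X * S n) * ('X * S n)); last by ring.
case: n => [|n]; first by rewrite recS0 LSSn norm_succ beta0 addr0.
rewrite recSS mulrDl !mulrDr -!scalerAl -!scalerAr !LD !LZ !LSSn.
rewrite !LSSne ?neq_ltn ?ltnS ?leqnSn ?orbT // !norm_succ; ring.
Qed.

(** With x S_n = S_(n+1) + beta_n S_(n-1), this is the square of
    x S_(n+1) + beta_n x S_(n-1): two second moments and a cross term, so only
    the first step of the recurrence is ever expanded. *)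
Lemma fourth_moment n : L ('X^4 * (S n * S n)) =
  (beta n.+1 * (beta n.+2 + beta n.+1) + 2 * beta n * beta n.+1
   + beta n * (beta n + beta n.-1)) * h n.
Proof.
case: n => [|n].
  rewrite (_ : _ * _ = 'X^2 * ('X * S 0%N * ('X * S 0%N))); last by ring.
  rewrite recS0 second_moment norm_succ beta0; ring.
rewrite (_ : _ * _ = 'X^2 * ('X * S n.+1 * ('X * S n.+1))); last by ring.
rewrite recSS (_ : _ * _ = 'X^2 * (S n.+2 * S n.+2)
   + (2 * beta n.+1) *: (('X * S n.+2) * ('X * S n))
   + (beta n.+1) ^+ 2 *: ('X^2 * (S n * S n))); last first.
  rewrite -!mul_polyC polyCM polyC_exp; ring.
have z k : (n < k)%N -> beta n * L (S k * prev_poly S n) = 0.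
  case: (n) => [|m] ltmk; first by rewrite beta0 mul0r.
  by rewrite LSSne ?mulr0 // ltn_eqF // ltnW.
have cross : L ('X * S n.+2 * ('X * S n)) = beta n.+2 * h n.+1.
  rewrite recSS recS mulrDl !mulrDr !LD -!scalerAl -!scalerAr !LZ LSSn.
  rewrite LSSne ?(ltn_eqF _) // ?ltnS ?leqW //.
  have -> : beta n * L (S n.+3 * prev_poly S n) = 0 by rewrite z // ltnS leqW.
  have -> : beta n * L (S n.+1 * prev_poly S n) = 0 by rewrite z.
  by rewrite !mulr0 !addr0 add0r.
rewrite !LD !LZ !second_moment cross !norm_succ /=; ring.
Qed.

(** The Euler operator x d/dx multiplies the leading term of S_n by n, so
    x S_n' is n S_n up to lower degree, which S_n does not see. *)
Lemma euler_moment n : L ('X * (S n * S n)^`()) = 2 * n%:R * h n.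
Proof.
rewrite derivM (_ : 'X * _ = 2 *: (S n * ('X * (S n)^`()))); last first.
  rewrite -mul_polyC; ring.
rewrite LZ -mulrA; congr (_ * _).
rewrite -(subrK (n%:R *: S n) ('X * _)) mulrDr LD -scalerAr LZ LSSn.
rewrite orthogonal_lower ?add0r //.
have [/monicP mS sS] := S_monic n.
apply/leq_sizeP => j lenj; rewrite coefB coefZ coefXM coef_deriv.
case: j lenj => [|j] lenj /=.
  by move: lenj; rewrite leqn0 => /eqP ->; rewrite mul0r subrr.
move: lenj; rewrite leq_eqVlt => /predU1P[->|ltnj].
  by rewrite mulr_natl subrr.
by rewrite !nth_default ?sS // mul0rn mulr0 subrr.
Qed.

(** The Pearson identity for S_n^2, divided by h_n. *)
Lemma string_add n :
  freud_string t beta n + freud_string t beta n.+1 = 2 * n%:R + 1 + al.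
Proof.
have hn0 : h n != 0 by rewrite gt_eqF.
have := pearson (S n * S n).
rewrite /pearson_poly 2!mulrDl mulNr -!scalerAl mul_polyC !LD LN !LZ LSSn.
rewrite euler_moment second_moment fourth_moment => E.
apply: (mulIf hn0); rewrite /freud_string /=.
apply/eqP; rewrite -subr_eq0 -oppr_eq0.
by apply/eqP; rewrite -[RHS]E; field.
Qed.

Lemma string_equation n : freud_string t beta n = n%:R + parity_part al n.
Proof.
elim: n => [|n IHn].
  by rewrite /freud_string /parity_part beta0 expr0 subrr !mulr0 !mul0r addr0.
apply: (addrI (freud_string t beta n)); rewrite string_add IHn.
rewrite /parity_part exprS -natr1.
by field.
Qed.

End StringEquation.

(** * Ladder relations and the differential equation *)

(** The pointwise elimination. Here s, s1, s2 stand for S_n and its derivatives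
    at x, u and u1 for S_(n-1) and its derivative, b and bm for beta_n and
    beta_(n-1), N for n, e for the parity term of the string equation, and
    c for beta_n + beta_(n+1) - t/2. The last three hypotheses are the lowering
    relation at n, its derivative, and the lowering relation at n - 1 rewritten
    by the recurrence. *)
Lemma ladder_elimination (R : realFieldType)
    (al t b bm c e N x s s1 s2 u u1 : R) :
  x != 0 -> x ^+ 2 + c != 0 ->
  e ^+ 2 = al * e -> 4 * b * (bm + c) = N + e ->
  x * s1 = 4 * b * x * (x ^+ 2 + c) * u - (4 * b * x ^+ 2 + e) * s ->
  s1 + x * s2 = 4 * b * (3 * x ^+ 2 + c) * u + 4 * b * x * (x ^+ 2 + c) * u1
    - 8 * b * x * s - (4 * b * x ^+ 2 + e) * s1 ->
  x * u1 = 4 * x * (x ^+ 2 + (b + bm - t / 2)) * (x * u - s)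
    - (4 * bm * x ^+ 2 + (al - e)) * u ->
  x * s2
  + (al - 4 * x ^+ 4 + 2 * t * x ^+ 2 - 2 * x ^+ 2 / (x ^+ 2 + c)) * s1
  + (4 * N * x ^+ 3 + 16 * x * b * c * (b + bm - t / 2)
     + 4 * x * (al - 2 * e + 1) * b
     - (8 * b * x ^+ 3 + 2 * e * x) / (x ^+ 2 + c)
     + 2 * e * x * (t - 1 / (2 * x ^+ 2))) * s = 0.
Proof.
move=> x0 d0 e2 strE Hs Hs1 Hu.
pose D := x ^+ 2 + c.
pose K := D + 2 * x ^+ 2
  + D * (4 * x ^+ 2 * (x ^+ 2 + (b + bm - t / 2)) - 4 * bm * x ^+ 2 - al + e).
apply: (mulfI (mulf_neq0 x0 d0)); rewrite mulr0.
move/eqP: e2; rewrite -subr_eq0 => /eqP e2.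
move/eqP: strE; rewrite -subr_eq0 => /eqP strE.
move/eqP: Hs; rewrite -subr_eq0 => /eqP Hs.
move/eqP: Hs1; rewrite -subr_eq0 => /eqP Hs1.
move/eqP: Hu; rewrite -subr_eq0 => /eqP Hu.
(* Multiplied by x D, the left-hand side is a linear combination of the five
   relations. The first two multipliers remove s2 and u1; K then collects the
   coefficient of 4 b x D u and removes u; the terms in s1 cancel, and those in
   s cancel by the relations for e ^ 2 and N. *)
transitivity (x * D * 0 + 4 * b * x * D ^+ 2 * 0 - K * 0 + D * s * 0
  - 4 * x ^+ 4 * D * s * 0); last by ring.
(* Each rewrite turns the first remaining 0 into its relation. *)
rewrite -{1}Hs1 -{1}Hu -{1}Hs -{1}e2 -{1}strE /K /D.
by field; rewrite d0 x0.
Qed.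

Section Ladder.
Variables (R : realType) (al t : R) (S : nat -> {poly R}).
Variables (beta : nat -> R).
Hypothesis S0 : S 0%N = 1.
Hypothesis beta0 : beta 0%N = 0.
Hypothesis recS : forall n, 'X * S n = S n.+1 + beta n *: prev_poly S n.
Hypothesis stringE : forall n, freud_string t beta n = n%:R + parity_part al n.

Let c n := beta n + beta n.+1 - t / 2.

(** Induction on two consecutive indices: differentiating
    S_(k+2) = x S_(k+1) - beta_(k+1) S_k expresses x S_(k+2)' through the
    relations at k + 1 and k, and the string equation matches the coefficients
    of S_(k+1). *)
Lemma lowering n : 'X * (S n)^`() =
  (4 * beta n) *: ('X * ('X^2 + (c n)%:P) * prev_poly S n)
  - ((4 * beta n) *: 'X^2 + (parity_part al n)%:P) * S n.
Proof.
have parityE k : parity_part al k = freud_string t beta k - k%:R.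
  by rewrite stringE addrC addKr.
have parity2 k : parity_part al k = parity_part al k.+2.
  by rewrite /parity_part !exprS mulrA mulrNN mul1r mul1r.
pose P k := 'X * (S k)^`() =
  (4 * beta k) *: ('X * ('X^2 + (c k)%:P) * prev_poly S k)
  - ((4 * beta k) *: 'X^2 + (parity_part al k)%:P) * S k.
rewrite -/(P n); suff: P n /\ P n.+1 by case.
have recS0 : S 1%N = 'X.
  by have := recS 0; rewrite /= S0 scaler0 addr0 mulr1.
elim: n => [|k [IH0 IH1]].
  split; rewrite /P !parityE /freud_string /=.
    by rewrite S0 derivC beta0 -!mul_polyC; ring.
  rewrite recS0 S0 derivX beta0 /c -!mul_polyC; ring.
split=> //; rewrite /P /=.
have recS1 : S k.+2 = 'X * S k.+1 - (beta k.+1)%:P * S k.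
  by rewrite recS /= mul_polyC addrK.
have prevE : (beta k)%:P * prev_poly S k = 'X * S k - S k.+1.
  by rewrite recS mul_polyC addrAC subrr add0r.
have IH0' : 'X * (S k)^`() = 4 * 'X * ('X^2 + (c k)%:P) * ('X * S k - S k.+1)
    - ((4 * beta k) *: 'X^2 + (parity_part al k)%:P) * S k.
  by rewrite -prevE IH0 -!mul_polyC; ring.
rewrite recS1 derivD derivN !derivM derivC derivX mul0r add0r mul1r.
transitivity ('X * S k.+1 + 'X * ('X * (S k.+1)^`())
  - (beta k.+1)%:P * ('X * (S k)^`())); first by ring.
(* The string values replace the parity parts at k + 1 and k + 2; the parity
   part at k must first be read at k + 2, or beta_(k-1) would come in. *)
rewrite IH1 IH0' -!mul_polyC (parity2 k) !parityE /freud_string /c /=; ring.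
Qed.

Lemma freud_ode n x : (0 < n)%N -> x != 0 -> x ^+ 2 + c n != 0 ->
  x * (S n)^`()^`().[x]
  + (al - 4 * x ^+ 4 + 2 * t * x ^+ 2 - 2 * x ^+ 2 / (x ^+ 2 + c n))
     * (S n)^`().[x]
  + (4 * n%:R * x ^+ 3 + 16 * x * beta n * c n * (beta n + beta n.-1 - t / 2)
     + 4 * x * (al - 2 * parity_part al n + 1) * beta n
     - (8 * beta n * x ^+ 3 + 2 * parity_part al n * x) / (x ^+ 2 + c n)
     + 2 * parity_part al n * x * (t - 1 / (2 * x ^+ 2))) * (S n).[x] = 0.
Proof.
case: n => // n _ x0 d0 /=.
have parityS : parity_part al n = al - parity_part al n.+1.
  by rewrite /parity_part exprS; field.
have parity2 : parity_part al n.+1 ^+ 2 = al * parity_part al n.+1.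
  have sq : ((-1) ^+ n.+1) ^+ 2 = 1 :> R by rewrite sqrr_sign.
  rewrite /parity_part.
  transitivity (al ^+ 2 * (1 - 2 * (-1) ^+ n.+1 + ((-1) ^+ n.+1) ^+ 2) / 4).
    by field.
  by rewrite sq; field.
have at_x (p q : {poly R}) : p = q -> p.[x] = q.[x] by move=> ->.
have hornerS := (hornerD, hornerN, hornerM, hornerZ, hornerXn, hornerX, hornerC).
apply: (@ladder_elimination _ _ _ _ (beta n) _ _ _ _ _ _ _
  (S n).[x] (S n)^`().[x]) => //.
- by rewrite -(stringE n.+1) /freud_string /c /=; ring.
- have := at_x _ _ (lowering n.+1); rewrite !hornerS /= => ->; ring.
- have /at_x := congr1 (@deriv R) (lowering n.+1).
  rewrite !(derivM, derivD, derivN, derivZ, derivC, derivX, derivXn) !hornerS /=.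
  by move=> E; apply: etrans (etrans E _); ring.
- have := at_x _ _ (recS n); rewrite !hornerS => E.
  have {}E : beta n * (prev_poly S n).[x] = x * (S n).[x] - (S n.+1).[x].
    by rewrite E addrC addKr.
  have := at_x _ _ (lowering n); rewrite !hornerS => ->.
  have -> : 4 * x * (x ^+ 2 + (beta n.+1 + beta n - t / 2)) *
      (x * (S n).[x] - (S n.+1).[x])
    = 4 * x * (x ^+ 2 + c n) * (beta n * (prev_poly S n).[x]).
    by rewrite E /c [beta n + _]addrC.
  by rewrite -parityS; ring.
Qed.
End Ladder.

(** * The Pearson identity for the Freud weight *)

Section Weight.
Variables (R : realType) (lambda t : R).
Let al : R := 2 * lambda + 1.
Let w := freud_weight lambda t.
Let mu := @lebesgue_measure R.

Lemma measurable_freud_weight : measurable_fun [set: R] w.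
Proof.
apply: measurable_funM.
  by apply: (measurableT_comp (measurable_powR _)); exact: normr_measurable.
apply: measurableT_comp; first exact: measurable_expR.
rewrite (_ : (fun x => _) = horner (- 'X^4 + t *: 'X^2)).
  exact: measurable_poly.
by apply/funext => x; rewrite !(hornerD, hornerN, hornerXn, hornerZ).
Qed.

(** Writing |x|^al as (x^2)^(al/2) makes the weight smooth away from 0 in one
    formula for both signs of x. *)
Lemma freud_weightE x : x != 0 ->
  w x = expR (al / 2 * ln (x ^+ 2) + (- 'X^4 + t *: 'X^2).[x]).
Proof.
move=> x0; rewrite !(hornerD, hornerN, hornerXn, hornerZ).
rewrite /w /freud_weight /powR normr_eq0 (negbTE x0) -expRD -/al.
have -> : ln (x ^+ 2) = ln `|x| *+ 2.
  by rewrite -(real_normK (num_real x)) lnXn ?normr_gt0.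
by congr expR; congr (_ + _); rewrite mulr2n; field.
Qed.

Lemma freud_weightN x : w (- x) = w x.
Proof.
have x4 : (- x) ^+ 4 = x ^+ 4 by ring.
by rewrite /w /freud_weight normrN sqrrN x4.
Qed.

Lemma freud_weight_ge0 x : 0 <= w x.
Proof. by rewrite mulr_ge0 ?powR_ge0 ?expR_ge0. Qed.

Lemma is_derive_freud_weight (x : R) : x != 0 ->
  is_derive x (1 : R) w (w x * (al / x - 4 * x ^+ 3 + 2 * t * x)).
Proof.
move=> x0.
have x2 : 0 < x ^+ 2 by rewrite exprn_even_gt0.
pose g := cst (al / 2) * (@ln R \o horner 'X^2) + horner (- 'X^4 + t *: 'X^2).
have wE y : y != 0 -> w y = expR (g y).
  by move=> y0; rewrite freud_weightE // /g !fctE /= hornerXn.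
apply: (@near_eq_is_derive _ _ _ (expR \o g)).
  have := open_nbhs_nbhs (conj (@open_neq R 0) x0 : open_nbhs x _).
  by apply: filterS => y /= y0; rewrite wE.
have dln : is_derive x (1 : R) (@ln R \o horner 'X^2) ((x ^+ 2)^-1 * (2 * x)).
  apply: is_derive_eq; first apply: is_derive1_comp.
    by rewrite hornerXn; exact: is_derive1_ln.
  by rewrite derivXn hornerMn !hornerXn expr1 mulr_natl.
have dg : is_derive x (1 : R) g (al / x - 4 * x ^+ 3 + 2 * t * x).
  apply: is_derive_eq.
  have scaleE (a b : R) : a *: b = a * b by [].
  rewrite !scaleE mulr0 addr0 derivD derivN derivZ !derivXn !hornerE /=.
  by field.
by rewrite wE //; exact: is_derive1_comp.
Qed.

Lemma is_derive_pearson (p : {poly R}) (x : R) : x != 0 ->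
  is_derive x (1 : R) (fun y => y * p.[y] * w y)
    ((pearson_poly al t p).[x] * w x).
Proof.
move=> x0; have dw := is_derive_freud_weight _ x0.
rewrite (_ : (fun y => _) = horner ('X * p) * w); last first.
  by apply/funext => y; rewrite !fctE hornerM hornerX.
apply: is_derive_eq.
have scaleE (a b : R) : a *: b = a * b by [].
rewrite !scaleE /= /pearson_poly derivM derivX mul1r.
rewrite !(hornerD, hornerN, hornerM, hornerZ, hornerXn, hornerX, hornerC).
by field.
Qed.

Lemma pearson_segment (p : {poly R}) (a b : R) :
  a < b -> {in `[a, b], forall x : R, x != 0} ->
  (\int[mu]_(x in `[a, b]) ((pearson_poly al t p).[x] * w x)%:E =
   (b * p.[b] * w b - a * p.[a] * w a)%:E)%E.
Proof.
move=> ab nz.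
have dG (x : R) : x \in `[a, b] -> derivable (fun y : R => y * p.[y] * w y) x 1.
  by move=> /nz x0; have [] := is_derive_pearson p _ x0.
have cG (x : R) : x \in `[a, b] ->
    {for x, continuous (fun y : R => y * p.[y] * w y)}.
  by move=> /dG dx; exact/differentiable_continuous/derivable1_diffP.
rewrite EFinB; apply: (@continuous_FTC2 _ _ (fun y => y * p.[y] * w y)) => //.
- apply: derivable_within_continuous => x /nz x0.
  apply: derivableM; first exact: derivable_horner.
  by have [] := is_derive_freud_weight _ x0.
- split.
  + by move=> x xab; apply: dG; exact: subset_itv_oo_cc xab.
  + by apply: cvg_at_right_filter; apply: cG; rewrite in_itv /= lexx ltW.
  + by apply: cvg_at_left_filter; apply: cG; rewrite in_itv /= lexx ltW.
- move=> x /subset_itv_oo_cc /nz x0; rewrite derive1E.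
  by have [_ ->] := is_derive_pearson p _ x0.
Qed.

Lemma cvg_inv_nat2 : n.+2%:R^-1 @[n --> \oo] --> (0 : R).
Proof.
apply: squeeze_cvgr; [|exact: (@cvg_cst _ (0 : R))|exact: cvg_harmonic].
apply: nearW => n; rewrite invr_ge0 ler0n /=.
by rewrite lef_pV2 ?posrE ?ltr0n // ler_nat.
Qed.

(** For large r, |r|^al is at most r^m and r^4 - t r^2 is at least r, so
    the weight is at most r^m exp(-r), and the exponential series bounds
    r^(k+m) exp(-r) by (k+m+1)! / r. *)
Lemma monomial_boundary_infty k :
  n.+2%:R ^+ k * w n.+2%:R @[n --> \oo] --> (0 : R).
Proof.
pose m := Num.bound `|al|.
have alm : al <= m%:R.
  exact: le_trans (ler_norm _) (ltW (archi_boundP (normr_ge0 _))).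
pose K := (k + m)%N.
apply: (@squeeze_cvgr _ _ _ _ (cst 0) (fun n => K.+1`!%:R * n.+2%:R^-1)).
- near=> n.
  set r : R := n.+2%:R.
  have r1 : 1 <= r by rewrite ler1n.
  have r0 : 0 < r := lt_le_trans ltr01 r1.
  have tr : t + 1 <= r ^+ 2.
    have : `|t + 1| <= r.
      apply: (@le_trans _ _ n%:R); last by rewrite ler_nat -addn2 leq_addr.
      by near: n; exact: nbhs_infty_ger.
    move/(le_trans (ler_norm _)) => /le_trans; apply; exact: ler_eXnr.
  rewrite mulr_ge0 ?exprn_ge0 ?freud_weight_ge0 ?(ltW r0) //=.
  have wle : w r <= r ^+ m * expR (- r).
    rewrite /w /freud_weight (gtr0_norm r0) ler_pM ?powR_ge0 ?expR_ge0 //.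
      by rewrite -(powR_mulrn _ (ltW r0)); exact: ler_powR.
    rewrite ler_expR -/al.
    have -> : - r ^+ 4 + t * r ^+ 2 = - (r ^+ 2 * (r ^+ 2 - t)) by ring.
    rewrite lerN2 (le_trans (ler_eXnr (isT : (0 < 2)%N) r1)) //.
    by rewrite ler_peMr ?exprn_ge0 ?(ltW r0) //; lra.
  rewrite (le_trans (ler_wpM2l _ wle)) ?exprn_ge0 ?(ltW r0) // mulrA -exprD -/K.
  rewrite expRN ler_pdivrMr ?expR_gt0 //.
  have eK : r ^+ K.+1 / K.+1`!%:R <= expR r.
    by apply: le_trans (expR_ge1Dxn K (ltW r0)); rewrite lerDr ler01.
  apply: le_trans (ler_wpM2l _ eK); last first.
    by rewrite mulr_ge0 ?invr_ge0 ?ler0n.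
  rewrite le_eqVlt exprS; apply/orP; left; apply/eqP; field.
  by rewrite gt_eqF //= pnatr_eq0 -lt0n fact_gt0.
- exact: cvg_cst.
- rewrite -[X in _ --> X](mulr0 K.+1`!%:R).
  by apply: cvgM; [exact: cvg_cst | exact: cvg_inv_nat2].
Unshelve. all: by end_near.
Qed.

Lemma boundary_infty (p : {poly R}) :
  p.[n.+2%:R] * w n.+2%:R @[n --> \oo] --> (0 : R).
Proof.
suff H k : p.[n.+2%:R] * n.+2%:R ^+ k * w n.+2%:R @[n --> \oo] --> (0 : R).
  rewrite (_ : (fun n => _) = (fun n => p.[n.+2%:R] * n.+2%:R ^+ 0 * w n.+2%:R)).
    exact: H.
  by apply/funext => n; rewrite expr0 mulr1.
(* Induction on p by Horner steps moves one factor x into the power. *)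
elim/poly_ind: p k => [|p c IH] k.
  by apply: cvg_near_cst; apply: nearW => n; rewrite horner0 !mul0r.
rewrite (_ : (fun n => _) = (fun n => p.[n.+2%:R] * n.+2%:R ^+ k.+1 * w n.+2%:R
    + c * (n.+2%:R ^+ k * w n.+2%:R))); last first.
  by apply/funext => n; rewrite hornerMXaddC exprS; ring.
rewrite -[X in _ --> X](addr0 0) -[X in _ --> _ + X](mulr0 c).
apply: cvgD; first exact: IH.
by apply: cvgM; [exact: cvg_cst | exact: monomial_boundary_infty].
Qed.

(** Here lambda > -1 enters: x w(x) behaves like x^(al + 1) with al + 1 > 0. *)
Lemma boundary_zero (p : {poly R}) : -1 < lambda ->
  n.+2%:R^-1 * p.[n.+2%:R^-1] * w n.+2%:R^-1 @[n --> \oo] --> (0 : R).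
Proof.
move=> hl.
have al1 : 0 < al + 1 by rewrite /al; lra.
have u0 n : 0 < n.+2%:R^-1 :> R by rewrite invr_gt0 ltr0n.
pose q : {poly R} := - 'X^4 + t *: 'X^2.
rewrite (_ : (fun n => _) = (fun n => p.[n.+2%:R^-1] * expR q.[n.+2%:R^-1]
    * n.+2%:R^-1 `^ (al + 1))); last first.
  apply/funext => n; rewrite -[in RHS](mulr_powRB1 (ltW (u0 n)) al1) addrK.
  rewrite /w /freud_weight gtr0_norm // -/al /q.
  by rewrite !(hornerD, hornerN, hornerXn, hornerZ); ring.
rewrite -[X in _ --> X](mulr0 (p.[0] * expR q.[0])).
apply: cvgM; last first.
  by move/cvg_at_rightP: (powR_cvg0 al1); apply; split => //; exact: cvg_inv_nat2.
apply: cvgM.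
  by apply: cvg_comp; [exact: cvg_inv_nat2 | exact: continuous_horner].
apply: (cvg_comp _ (@expR R) _ (@continuous_expR R _)).
by apply: cvg_comp; [exact: cvg_inv_nat2 | exact: continuous_horner].
Qed.

(** The primitive x p w is singular at 0, so the fundamental theorem of calculus
    is applied on [-r, -1/r] and [1/r, r]. The boundary terms tend to 0, and by
    dominated convergence the integrals tend to the integral over the line; at
    the omitted point 0, a null set, the convergence may fail. *)
Lemma integral_pearson (p : {poly R}) : -1 < lambda ->
  mu.-integrable [set: R] (fun x => ((pearson_poly al t p).[x] * w x)%:E) ->
  (\int[mu]_x ((pearson_poly al t p).[x] * w x)%:E = 0)%E.
Proof.
move=> hl; set f := fun x => _; move=> fi.
pose r n : R := n.+2%:R.
pose D n := `[- r n, - (r n)^-1]%classic `|` `[(r n)^-1, r n]%classic.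
have r_gt1 n : 1 < r n by rewrite ltr1n.
have mD n : measurable (D n) by apply: measurableU; exact: measurable_itv.
pose G x := x * p.[x] * w x.
have intD n : (\int[mu]_(x in D n) f x =
   ((G (r n) - G (r n)^-1) + (G (- (r n)^-1) - G (- r n)))%:E)%E.
  have r0 : 0 < r n := lt_trans ltr01 (r_gt1 n).
  have rV : (r n)^-1 < r n by rewrite (lt_trans _ (r_gt1 n)) // invf_lt1.
  have rV0 : 0 < (r n)^-1 by rewrite invr_gt0.
  rewrite integral_setU //=; first last.
  - rewrite disj_set2E; apply/eqP/seteqP; split => // x /=.
    rewrite !in_itv /= => -[/andP[_ h1] /andP[h2 _]].
    have := lt_le_trans rV0 (le_trans h2 h1).
    by rewrite oppr_gt0 ltNge ltW.
  - by apply: measurable_funTS; exact: measurable_int fi.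
  rewrite addeC /f pearson_segment //; last first.
    move=> x; rewrite in_itv /= => /andP[h _].
    by rewrite gt_eqF // (lt_le_trans rV0).
  rewrite pearson_segment ?ltrN2 // => x; rewrite in_itv /= => /andP[_ h].
  by rewrite lt_eqF // (le_lt_trans h) // oppr_lt0.
have lim0 :
    (G (r n) - G (r n)^-1) + (G (- (r n)^-1) - G (- r n)) @[n --> \oo] --> 0.
  have bi := boundary_infty ('X * p).
  have biN := boundary_infty ('X * (p \Po - 'X)).
  have bz := boundary_zero p hl.
  have bzN := boundary_zero (p \Po - 'X) hl.
  (* The weight is even, so the boundary terms on the left are those on the
     right for p(-x). *)
  have GN x : G (- x) = - (x * (p \Po - 'X).[x] * w x).
    by rewrite /G freud_weightN horner_comp hornerN hornerX !mulNr.
  have -> : (fun n => G (r n) - G (r n)^-1 + (G (- (r n)^-1) - G (- r n))) =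
    (fun n => (('X * p).[n.+2%:R] * w n.+2%:R
      - n.+2%:R^-1 * p.[n.+2%:R^-1] * w n.+2%:R^-1)
      + (('X * (p \Po - 'X)).[n.+2%:R] * w n.+2%:R
      - n.+2%:R^-1 * (p \Po - 'X).[n.+2%:R^-1] * w n.+2%:R^-1)).
    apply/funext => n; rewrite !GN /G /r !hornerM !hornerX opprK.
    by congr (_ + _); rewrite addrC.
  rewrite (_ : 0 = (0 - 0) + (0 - 0) :> R); last by rewrite !subr0 addr0.
  by apply: cvgD; apply: cvgB.
have restr_le n x : (`|(f \_ (D n)) x| <= `|f x|)%E.
  by rewrite patchE; case: ifP => // _; rewrite abse0.
have restr_cvg x : x != 0 -> (f \_ (D n)) x @[n --> \oo] --> f x.
  move=> x0; apply: cvg_near_cst.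
  near=> n.
  rewrite patchE mem_set //.
  have nr : n%:R <= r n by rewrite ler_nat -addn2 leq_addr.
  have xr : `|x| <= r n.
    by apply: le_trans nr; near: n; exact: nbhs_infty_ger.
  have xV : (r n)^-1 <= `|x|.
    rewrite -[leRHS]invrK lef_pV2 ?posrE ?invr_gt0 ?normr_gt0 //.
    by apply: le_trans nr; near: n; exact: nbhs_infty_ger.
  rewrite /D /= !in_itv /=.
  have [xlt|xgt|xeq] := ltgtP x 0.
  - by left; move: xr xV; rewrite ltr0_norm // => h1 h2; rewrite lerNl h1 lerNr h2.
  - by right; move: xr xV; rewrite gtr0_norm // => -> ->.
  - by rewrite xeq eqxx in x0.
have mf : measurable_fun [set: R] f := measurable_int mu fi.
have mfD n : measurable_fun [set: R] (f \_ (D n)).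
  by apply/measurable_restrict => //; exact: measurable_funTS.
have ae_cvg : {ae mu, forall x, [set: R] x -> (f \_ (D n)) x @[n --> \oo] --> f x}.
  exists [set 0]; split => //; first exact: lebesgue_measure_set1.
  move=> x /= nx; apply/eqP; apply: contra_notT nx => x0 _; exact: restr_cvg.
have ae_le : {ae mu, forall x n, [set: R] x -> (`|(f \_ (D n)) x| <= `|f x|)%E}.
  by apply: aeW => x n _; exact: restr_le.
have [_ _] := @dominated_convergence _ _ _ mu _ measurableT _ _ _
  mfD mf ae_cvg (integrable_abse fi) ae_le.
have -> : (fun n => \int[mu]_x (f \_ (D n)) x)%E = (fun n =>
    ((G (r n) - G (r n)^-1) + (G (- (r n)^-1) - G (- r n)))%:E).
  by apply/funext => n; rewrite -integral_mkcond intD.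
move=> /cvg_unique; apply; first exact: ereal_hausdorff.
by apply: cvg_EFin; [exact: nearW | exact: lim0].
Unshelve. all: by end_near.
Qed.
End Weight.

(** Finiteness of the norms h_n makes each S_n^2 w integrable; S_n w is dominated
    by (S_n^2 + 1) w, and the S_n span all polynomials. *)
Lemma integrable_poly_weight (R : realType) (lambda t : R) (S : nat -> {poly R})
    (p : {poly R}) :
  S 0%N = 1 -> monic_orthogonal_polys (freud_weight lambda t) S ->
  (@lebesgue_measure R).-integrable [set: R]
    (fun x => (p.[x] * freud_weight lambda t x)%:E).
Proof.
move=> S0 [S_monic [h _ hint]].
set w := freud_weight lambda t.
have mp (q : {poly R}) : measurable_fun [set: R] (fun x => (q.[x] * w x)%:E).
  apply/measurable_EFinP; apply: measurable_funM.
    exact: measurable_poly.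
  exact: measurable_freud_weight.
have sqi n : (@lebesgue_measure R).-integrable [set: R]
    (fun x => ((S n * S n).[x] * w x)%:E).
  apply/integrableP; split; first exact: mp.
  rewrite (le_lt_trans _ (ltry (h n * (n == n)%:R))) // -hint.
  rewrite le_eqVlt; apply/orP; left; apply/eqP.
  apply: eq_integral => x _ /=; rewrite hornerM ger0_norm //.
  by rewrite mulr_ge0 ?freud_weight_ge0 // -expr2 sqr_ge0.
apply: (@monic_seq_span R S (fun q => (@lebesgue_measure R).-integrable [set: R]
    (fun x => (q.[x] * w x)%:E)) (size p)) => //.
- rewrite (_ : (fun x => _) = cst 0%E); first exact: integrable0.
  by apply/funext => x; rewrite horner0 mul0r.
- move=> q r qi ri; apply: eq_integrable (integrableD measurableT qi ri) => //.
  by move=> x _ /=; rewrite hornerD mulrDl EFinD.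
- move=> c q qi; apply: eq_integrable (integrableZl measurableT c qi) => //.
  by move=> x _ /=; rewrite hornerZ -mulrA EFinM.
- move=> k _.
  apply: le_integrable (integrableD measurableT (sqi k) (sqi 0%N)) => //.
    exact: mp.
  move=> x _ /=; rewrite lee_fin -mulrDl !normrM.
  apply: ler_wpM2r => //.
  rewrite S0 hornerM hornerM hornerC mulr1 -expr2.
  rewrite [leRHS]ger0_norm; last by rewrite addr_ge0 ?sqr_ge0.
  rewrite -[(S k).[x] ^+ 2]real_normK ?num_real //.
  have := sqr_ge0 (`|(S k).[x]| - 1).
  have : 0 <= `|(S k).[x]| by [].
  nra.
Qed.

(** * The differential equation *)

Theorem theorem4p9 (R : realType) (lambda t : R) (S : nat -> {poly R})
    (beta : nat -> R) (hlambda : -1 < lambda)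
    (hS : monic_orthogonal_polys (freud_weight lambda t) S)
    (hbeta : recurrence_coefs S beta)
    (n : nat) (hn : (0 < n)%N) (x : R) (hx : x != 0)
    (hden : freud_den t beta n x != 0) :
  x * (horner (S n))^`(2)%classic x
  + freud_R lambda t beta n x * (horner (S n))^`()%classic x
  + freud_T lambda t beta n x * (S n).[x] = 0.
Proof.
have [S0 beta0 recS] := hbeta.
have [S_monic [h h_gt0 hint]] := hS.
pose al : R := 2 * lambda + 1.
pose L (p : {poly R}) :=
  \int[@lebesgue_measure R]_(x in [set: R]) (p.[x] * freud_weight lambda t x).
have int_w p := @integrable_poly_weight R lambda t S p S0 hS.
have LD p q : L (p + q) = L p + L q.
  rewrite /L -RintegralD //; try exact: int_w.
  by apply: eq_Rintegral => y _; rewrite hornerD mulrDl.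
have LZ c p : L (c *: p) = c * L p.
  rewrite /L -RintegralZl //; last exact: int_w.
  by apply: eq_Rintegral => y _; rewrite hornerZ; exact/esym/mulrA.
have LSS i j : L (S j * S i) = h j * (i == j)%:R.
  rewrite /L /Rintegral; under eq_integral do rewrite hornerM.
  by rewrite hint.
have pearson p : L (pearson_poly al t p) = 0.
  by rewrite /L /Rintegral integral_pearson.
have stringE k : freud_string t beta k = k%:R + parity_part al k.
  exact: (@string_equation R al t S beta h S_monic beta0 recS L).
have denE : freud_den t beta n x = x ^+ 2 + (beta n + beta n.+1 - t / 2).
  by rewrite /freud_den; ring.
rewrite denE in hden.
have := @freud_ode R al t S beta S0 beta0 recS stringE n x hn hx hden.
rewrite derive1nS derive1n1 -!derivE => <-.
rewrite /freud_R /freud_T denE /parity_part /al.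
field.
rewrite hx /=; apply: contraNneq hden => E.
by apply/eqP; rewrite -(mul0r 2^-1) -E; field.
Qed.
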